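(* Let $n\ge2$, let $A\in\mathbb{R}^{n\times n}$ be Metzler, output unstable and nonsingular, $b_0\in\mathbb{R}^n_{\ge0}$ with $g_0:=-e_n^TA^{-1}b_0<0$, and let $\mu,\theta>0$, $r:=\mu/\theta$, $g_n:=-e_n^TA^{-1}e_n$, $u_*:=(g_0-r)/(g_nr)$. Then for all $\eta,k_p>0$ the equilibrium $\big(-A^{-1}(b_0-ru_*e_n),\ \mu/(\eta u_* ),\ u_*/k_p\big)$ of the system $\dot x=Ax-k_px_nz_2e_n+b_0$, $\dot z_1=\mu-k_p\eta z_1z_2$, $\dot z_2=\theta x_n-k_p\eta z_1z_2$ is locally exponentially stable.
   Context: $S:=[e_1\ \cdots\ e_{n-1}]$, $e_i$ standard basis vectors; $x_n=e_n^Tx$. Metzler: all off-diagonal entries nonnegative. Hurwitz stable: all eigenvalues have negative real part. $M$ is output unstable if $S^TMS$ is Hurwitz stable and $e_n^TMe_n>0$. An equilibrium is called locally exponentially stable here if the Jacobian matrix of the vector field at the equilibrium is Hurwitz stable. *)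

(* Defs.v *)
From HB Require Import structures.
From mathcomp Require Import all_boot all_order all_algebra.
From mathcomp Require Import all_classical all_reals all_analysis.
From mathcomp Require Import complex.
Set Implicit Arguments. Unset Strict Implicit. Unset Printing Implicit Defensive.
Import Order.TTheory GRing.Theory Num.Theory.
Local Open Scope ring_scope.

Definition Metzler (R : realType) (m : nat) (M : 'M[R]_m) : Prop :=
  forall i j : 'I_m, i != j -> 0 <= M i j.

Definition Hurwitz (R : realType) (m : nat) (M : 'M[R]_m) : Prop :=
  forall l : R[i], eigenvalue (map_mx (fun x : R => (x%:C)%C) M) l ->
    complex.Re l < 0.

Lemma lastIdx_proof (n : nat) (hn : (0 < n)%N) : (n.-1 < n)%N.
Proof. by rewrite prednK. Qed.
Definition lastIdx (n : nat) (hn : (0 < n)%N) : 'I_n := Ordinal (lastIdx_proof hn).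

Definition ebasis (R : realType) (n : nat) (i : 'I_n) : 'cV[R]_n := delta_mx i 0.

Definition Smat (R : realType) (n : nat) : 'M[R]_(n, n.-1) :=
  \matrix_(i < n, j < n.-1) (i == widen_ord (leq_pred n) j)%:R.

Definition output_unstable (R : realType) (n : nat) (hn : (0 < n)%N)
  (M : 'M[R]_n) : Prop :=
  Hurwitz ((Smat R n)^T *m M *m Smat R n) /\
  0 < ((ebasis R (lastIdx hn))^T *m M *m ebasis R (lastIdx hn)) 0 0.

Definition jacobian (R : realType) (m : nat) (F : 'cV[R]_m -> 'cV[R]_m)
  (p : 'cV[R]_m) : 'M[R]_m :=
  \matrix_(i, j) derive1 (fun t : R => F (p + t *: delta_mx j 0) i 0) 0.

Definition loc_exp_stable (R : realType) (m : nat) (F : 'cV[R]_m -> 'cV[R]_m)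
  (p : 'cV[R]_m) : Prop := Hurwitz (jacobian F p).

Definition vfield (R : realType) (n : nat) (hn : (0 < n)%N) (A : 'M[R]_n)
  (b0 : 'cV[R]_n) (mu theta eta kp : R) (s : 'cV[R]_(n + 2)) : 'cV[R]_(n + 2) :=
  let x : 'cV[R]_n := usubmx s in
  let z1 := dsubmx s 0 0 in
  let z2 := dsubmx s 1 0 in
  let xn := x (lastIdx hn) 0 in
  col_mx (A *m x - (kp * xn * z2) *: ebasis R (lastIdx hn) + b0)
         (\col_(k < 2) (if k == 0 then mu - kp * eta * z1 * z2
                        else theta * xn - kp * eta * z1 * z2)).

(* Main.v *)
(** Write [N = S^T A S], [b] and [c^T] for the blocks of [A] around its last
    diagonal entry [d], and [p = kp mu / ustar], [q = eta ustar]. For an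
    eigenvalue [l] of the Jacobian with [Re l >= 0], eliminating the controller
    states from a right eigenvector whose last plant component is 1 gives
      d + c^T (l - N)^-1 b
        = l + ustar + (p ustar / (p + q)) (q / l + p / (l + p + q)).
    The right-hand side has real part at least [ustar]. Since [N] is Metzler
    and Hurwitz, the left-hand side has modulus at most its value
    [h = d - c^T N^-1 b > 0] at [l = 0]. But [h] is the Schur complement of [N]
    in [A], so [gn = - 1 / h] and [ustar = h (1 - g0 / r) > h], a
    contradiction. *)

Require Import Defs.
From HB Require Import structures.
From mathcomp Require Import all_boot all_order all_algebra.
From mathcomp Require Import all_classical all_reals all_analysis.
From mathcomp Require Import complex ring lra.
Import Order.TTheory GRing.Theory Num.Theory.
Import numFieldNormedType.Exports.
Local Open Scope ring_scope.

Set Implicit Arguments.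
Unset Strict Implicit.
Unset Printing Implicit Defensive.

Lemma Metzler_mulmx_ge0 (R : realType) (m : nat) (N : 'M[R]_m) (y : 'cV[R]_m) i :
  Metzler N -> (forall j, 0 <= y j 0) -> y i 0 = 0 -> 0 <= (N *m y) i 0.
Proof.
move=> NM y0 yi; rewrite mxE; apply: sumr_ge0 => j _.
have [->|ij] := eqVneq j i; first by rewrite yi mulr0.
by apply: mulr_ge0 => //; apply: NM; rewrite eq_sym.
Qed.

Lemma Metzler_strict_pos (R : realType) (m : nat) (N : 'M[R]_m) (y : 'cV[R]_m) :
  Metzler N -> (forall i, (N *m y) i 0 < 0) -> (forall i, 0 <= y i 0) ->
  forall i, 0 < y i 0.
Proof.
move=> NM Ny y0 i; rewrite lt_neqAle y0 andbT; apply/eqP => yi.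
by have := Metzler_mulmx_ge0 NM y0 (esym yi); rewrite leNgt Ny.
Qed.

Lemma Metzler_min_principle (R : realType) (m : nat) (N : 'M[R]_m)
    (w y : 'cV[R]_m) :
  Metzler N -> (forall i, 0 < w i 0) -> (forall i, (N *m w) i 0 < 0) ->
  (forall i, (N *m y) i 0 <= 0) -> forall i, 0 <= y i 0.
Proof.
move=> NM w0 Nw Ny k; rewrite leNgt; apply/negP => yk.
have [i _ imin] : {i | true & forall j, true -> y i 0 / w i 0 <= y j 0 / w j 0}.
  by case: (@arg_minP _ _ _ k predT (fun j => y j 0 / w j 0)) => // i _ h; exists i.
set t := y i 0 / w i 0 in imin.
have t0 : t < 0.
  by apply: le_lt_trans (imin k isT) _; rewrite ltr_pdivrMr ?mul0r.
have := Metzler_mulmx_ge0 (y := y - t *: w) (i := i) NM.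
case/(_ _ _)/Wrap => [j||].
- by rewrite !mxE subr_ge0 -ler_pdivlMr ?imin.
- by rewrite !mxE /t divfK ?subrr ?gt_eqF.
rewrite mulmxBr -scalemxAr mxE [X in _ + X]mxE [X in - X]mxE leNgt => /negP[].
have : 0 < t * (N *m w) i 0 by rewrite nmulr_rgt0.
by have := Ny i; lra.
Qed.

Lemma continuous_family_pos (R : realType) (m : nat) (f : 'I_m -> R -> R) (a b : R) :
  a <= b -> (forall i, continuous (f i)) -> (forall i, 0 < f i b) ->
  (forall s, a <= s -> (forall i, 0 <= f i s) -> forall i, 0 < f i s) ->
  forall i, 0 < f i a.
Proof.
move=> ab fc fb step i; rewrite ltNge; apply/negP => fia.
pose g s := \big[Num.min/1]_(j < m) f j s.
have gc : continuous g.
  rewrite /g; elim: (index_enum _) => [|j s IH] x.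
    by under eq_fun do rewrite big_nil; exact: cvg_cst.
  under eq_fun do rewrite big_cons.
  by apply: continuous_min; [exact: fc|exact: IH].
have gb : 0 <= g b by apply/bigmin_geP; split => [|j _]; [exact: ler01|exact/ltW].
have ga : g a <= 0 by apply: le_trans fia; exact: bigmin_le_cond.
have [|s /[!in_itv]/= /andP[as_ _] gs] := @IVT R g a b 0 ab (continuous_subspaceT gc).
  by rewrite ge_min ga le_max gb orbT.
have fs j : 0 <= f j s by rewrite -gs; exact: bigmin_le_cond.
have : 0 < g s by apply/bigmin_gtP; split => [|j _]; [exact: ltr01|exact: step].
by rewrite gs ltxx.
Qed.

Lemma Hurwitz_shift_unit (R : realType) (m : nat) (N : 'M[R]_m) (s : R) :
  Hurwitz N -> 0 <= s -> s%:M - N \in unitmx.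
Proof.
move=> NH s0; rewrite unitmxE unitfE; apply/negP => det0.
have /NH : eigenvalue (map_mx (real_complex R) N) (s%:C)%C.
  rewrite eigenvalue_root_char -map_char_poly fmorph_root /root /char_poly.
  rewrite -horner_evalE -det_map_mx map_mxB map_scalar_mx /= horner_evalE hornerX.
  rewrite (_ : map_mx _ _ = N) //.
  by apply/matrixP => i j; rewrite !mxE horner_evalE hornerC.
by rewrite ltNge s0.
Qed.

(* [y s] is [(s - N)^-1 1] scaled by [det (s - N) ^+ 2], which makes its entries
   polynomials in [s]. They are positive for large [s], and going down to [s = 0]
   none can vanish first: row [i] of [(N - s) y < 0] fails where [y >= 0] and
   [y i = 0]. *)
Lemma Hurwitz_Metzler_supersolution (R : realType) (m : nat) (N : 'M[R]_m) :
  Metzler N -> Hurwitz N ->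
  exists2 w : 'cV[R]_m, forall i, 0 < w i 0 & forall i, (N *m w) i 0 < 0.
Proof.
move=> NM NH.
pose M := char_poly_mx N.
pose P : 'cV[{poly R}]_m := \det M *: (\adj M *m const_mx 1).
pose y (s : R) : 'cV[R]_m := map_mx (horner_eval s) P.
have ME s : map_mx (horner_eval s) M = s%:M - N.
  rewrite map_mxB map_scalar_mx /= horner_evalE hornerX; congr (_ - _).
  by apply/matrixP => i j; rewrite !mxE horner_evalE hornerC.
have yE s : (s%:M - N) *m y s = const_mx (\det (s%:M - N) ^+ 2).
  rewrite -(ME s) -map_mxM -scalemxAr mulmxA mul_mx_adj mul_scalar_mx scalerA.
  rewrite -expr2; apply/matrixP => i j.
  by rewrite !mxE mulr1 rmorphXn /= det_map_mx.
have shiftM s : Metzler (N - s%:M).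
  by move=> i j ij; rewrite !mxE (negbTE ij) subr0 NM.
have neg s i : 0 <= s -> ((N - s%:M) *m y s) i 0 < 0.
  move=> s0; rewrite -opprB mulNmx yE !mxE oppr_lt0 exprn_even_gt0 //=.
  by rewrite -unitfE -unitmxE Hurwitz_shift_unit.
exists (y 0) => i; last by have := neg 0 i (lexx _); rewrite raddf0 subr0.
pose b : R := 1 + \sum_i `|\sum_j N i j|.
have b0 : 0 <= b by rewrite addr_ge0 ?sumr_ge0.
apply: (@continuous_family_pos R m (fun i s => y s i 0) 0 b b0 _ _ _ i).
- move=> j; rewrite /y; under eq_fun do rewrite mxE horner_evalE.
  exact: continuous_horner.
- apply: (Metzler_strict_pos (shiftM b)) => [j|]; first exact: neg.
  apply: (@Metzler_min_principle _ _ _ (const_mx 1) _ (shiftM b)) => j.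
  + by rewrite mxE.
  + rewrite mulmxBl mul_scalar_mx !mxE mulr1.
    under eq_bigr do rewrite mxE mulr1.
    rewrite subr_lt0 /b [ltRHS](_ : _ = 1 + (`|\sum_j0 N j j0|
      + \sum_(k | k != j) `|\sum_j0 N k j0|)); last first.
      by rewrite [in LHS](bigD1 j).
    have := ler_norm (\sum_j0 N j j0).
    have : 0 <= \sum_(k | k != j) `|\sum_j0 N k j0| by exact: sumr_ge0.
    lra.
  + exact/ltW/neg.
- move=> s s0; apply: (Metzler_strict_pos (shiftM s)) => j; exact: neg.
Qed.

Lemma eigenvalue_right (F : fieldType) (m : nat) (M : 'M[F]_m) (l : F) :
  eigenvalue M l -> exists2 u : 'cV[F]_m, M *m u = l *: u & u != 0.
Proof.
rewrite /eigenvalue /eigenspace kermx_eq0 /row_free -mxrank_tr => Ml.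
have /eigenvalueP[v vM v0] : eigenvalue M^T l.
  by rewrite /eigenvalue /eigenspace kermx_eq0 /row_free -tr_scalar_mx -raddfB.
exists v^T; last by rewrite trmx_eq0.
by rewrite -[M]trmxK -trmx_mul vM linearZ.
Qed.

Local Notation normc := ComplexField.Normc.normc.

Lemma Re_le_normc (R : rcfType) (z : R[i]) : complex.Re z <= normc z.
Proof.
case: z => a b /=; apply: le_trans (ler_norm _) _.
by rewrite -sqrtr_sqr ler_wsqrtr // lerDl sqr_ge0.
Qed.

Lemma normc_nneg (R : rcfType) (z : R[i]) : 0 <= normc z.
Proof. by case: z => ? ?; exact: sqrtr_ge0. Qed.

Lemma normc_real (R : rcfType) (a : R) : 0 <= a -> normc (a%:C)%C = a.
Proof. by move=> a0; rewrite /= expr0n addr0 sqrtr_sqr ger0_norm. Qed.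

Lemma normc_sum (R : rcfType) (I : finType) (P : pred I) (F : I -> R[i]) :
  normc (\sum_(i | P i) F i) <= \sum_(i | P i) normc (F i).
Proof.
elim/big_rec2: _ => [|i a z _ h]; first by rewrite ComplexField.Normc.normc0.
by apply: le_trans (le_normcD _ _) _; rewrite lerD2l.
Qed.

Lemma Metzler_resolvent_bound (R : realType) (m : nat) (N : 'M[R]_m)
    (w Y b : 'cV[R]_m) (l xi : R[i]) (y : 'I_m -> R[i]) :
  Metzler N -> (forall i, 0 < w i 0) -> (forall i, (N *m w) i 0 < 0) ->
  N *m Y = - b -> (forall i, 0 <= b i 0) -> 0 <= complex.Re l ->
  (forall i, \sum_j ((N i j)%:C)%C * y j + ((b i 0)%:C)%C * xi = l * y i) ->
  forall i, normc (y i) <= normc xi * Y i 0.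
Proof.
move=> NM w0 Nw NY b0 l0 yE i.
pose v : 'cV[R]_m := normc xi *: Y - \col_j normc (y j).
suff : 0 <= v i 0 by rewrite !mxE subr_ge0.
apply: (Metzler_min_principle NM w0 Nw) => {}i.
rewrite mulmxBr -scalemxAr NY !mxE (bigD1 i) //= mxE.
have diag : (- N i i) * normc (y i) <=
    normc xi * b i 0 + \sum_(j | j != i) N i j * normc (y j).
  apply: (@le_trans _ _ (normc ((l - ((N i i)%:C)%C) * y i))).
    rewrite ComplexField.Normc.normcM ler_wpM2r ?normc_nneg //.
    apply: le_trans (Re_le_normc _); rewrite [leRHS](_ : _ = complex.Re l - N i i).
      by rewrite lerDr.
    by case: (l).
  rewrite mulrBl -yE (bigD1 i) //= [X in normc X](_ : _ =
    ((b i 0)%:C)%C * xi + \sum_(j | j != i) ((N i j)%:C)%C * y j); last by ring.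
  apply: le_trans (le_normcD _ _) _.
  rewrite ComplexField.Normc.normcM normc_real // mulrC lerD2l.
  apply: le_trans (normc_sum _ _) _; apply: ler_sum => j ji.
  by rewrite ComplexField.Normc.normcM normc_real // NM // eq_sym.
under eq_bigr do rewrite mxE.
lra.
Qed.

Lemma derive1_quadratic (R : realType) (f : R -> R) (a b c : R) :
  (forall t, f t = a + b * t + c * t ^+ 2) -> derive1 f 0 = b.
Proof.
move=> fE; pose p : {poly R} := a%:P + b *: 'X + c *: 'X^2.
have -> : f = horner p by apply/funext => t; rewrite fE !hornerE; ring.
rewrite -derivE.
by rewrite /p !(derivD, derivC, derivZ, derivX, derivXn) !hornerE /=; ring.
Qed.

Lemma ord2_total (k : 'I_2) : (k == 0) || (k == 1).
Proof. by case: k => [[|[|//]]] ?. Qed.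

Lemma derive1_vfield (R : realType) (n : nat) (hn : (0 < n)%N) (A : 'M[R]_n)
    (b0 : 'cV[R]_n) (mu theta eta kp : R) (x dx : 'cV[R]_n) (z dz : 'cV[R]_2) i :
  let o := lastIdx hn in
  derive1 (fun t : R =>
    vfield hn A b0 mu theta eta kp (col_mx x z + t *: col_mx dx dz) i 0) 0 =
  col_mx (A *m dx - (kp * (dx o 0 * z 1 0 + x o 0 * dz 1 0)) *: ebasis R o)
         (\col_k ((k == 1)%:R * (theta * dx o 0) -
                  kp * eta * (dz 0 0 * z 1 0 + z 0 0 * dz 1 0))) i 0.
Proof.
move=> o; rewrite /vfield -/o; case: (split_ordP i) => k ->.
  rewrite col_mxEu; apply: (@derive1_quadratic _ _
    ((A *m x - (kp * x o 0 * z 1 0) *: ebasis R o + b0) k 0) _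
    (- (kp * dx o 0 * dz 1 0) * ebasis R o k 0)) => t.
  rewrite scale_col_mx add_col_mx col_mxEu col_mxKu col_mxKd mulmxDr -scalemxAr.
  by rewrite !(mxE, =^~ mulrDl) /=; ring.
rewrite col_mxEd; apply: (@derive1_quadratic _ _
    ((k == 0)%:R * mu + (k == 1)%:R * theta * x o 0 - kp * eta * z 0 0 * z 1 0) _
    (- (kp * eta * dz 0 0 * dz 1 0))) => t.
rewrite scale_col_mx add_col_mx col_mxEd col_mxKu col_mxKd !mxE.
by case/orP: (ord2_total k) => /eqP -> /=; ring.
Qed.

Lemma jacobian_vfield (R : realType) (n : nat) (hn : (0 < n)%N) (A : 'M[R]_n)
    (b0 : 'cV[R]_n) (mu theta eta kp : R) (x : 'cV[R]_n) (z : 'cV[R]_2) :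
  let o := lastIdx hn in
  Defs.jacobian (vfield hn A b0 mu theta eta kp) (col_mx x z) =
  block_mx (A - (kp * z 1 0) *: delta_mx o o)
           (\matrix_(i, k) - (kp * x o 0 * ((i == o) && (k == 1))%:R))
           (\matrix_(k, j) (theta * ((k == 1) && (j == o))%:R))
           (\matrix_(k, l) - (kp * eta * z (if l == 0 then 1 else 0) 0)).
Proof.
move=> o; apply/matrixP => i j; rewrite mxE.
case: (split_ordP j) => k ->.
  have -> : delta_mx (lshift 2 k) 0 = col_mx (delta_mx k 0) 0 :> 'cV[R]_(n + 2).
    apply/colP => l; case: (split_ordP l) => l' ->.
      by rewrite col_mxEu !mxE eq_lshift.
    by rewrite col_mxEd !mxE eq_rlshift.
  rewrite derive1_vfield -/o; case: (split_ordP i) => l ->.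
    rewrite block_mxEul col_mxEu -colE !mxE eqxx !andbT mulr0 addr0.
    by rewrite (eq_sym o k); case: eqP; case: eqP => * /=; ring.
  rewrite block_mxEdl col_mxEd !mxE !andbT /= (eq_sym o k).
  by case: eqP; case: eqP => * /=; ring.
have -> : delta_mx (rshift n k) 0 = col_mx 0 (delta_mx k 0) :> 'cV[R]_(n + 2).
  apply/colP => l; case: (split_ordP l) => l' ->.
    by rewrite col_mxEu !mxE eq_lrshift.
  by rewrite col_mxEd !mxE eq_rshift.
rewrite derive1_vfield -/o; case: (split_ordP i) => l ->.
  rewrite block_mxEur col_mxEu mulmx0 !mxE !andbT (eq_sym 1 k).
  by case: eqP; case: eqP => * /=; ring.
rewrite block_mxEdr col_mxEd !mxE !andbT.
by case/orP: (ord2_total k) => /eqP -> /=; ring.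
Qed.

Lemma sum_lastIdx (V : nmodType) (n : nat) (hn : (0 < n)%N) (F : 'I_n -> V) :
  \sum_i F i = \sum_j F (widen_ord (leq_pred n) j) + F (lastIdx hn).
Proof.
case: n hn F => // n hn F; rewrite big_ord_recr /=; congr (_ + F _); last exact: val_inj.
by apply: eq_bigr => j _; congr F; apply: val_inj.
Qed.

Lemma Smat_conjE (R : realType) (n : nat) (M : 'M[R]_n) i j :
  ((Smat R n)^T *m M *m Smat R n) i j =
  M (widen_ord (leq_pred n) i) (widen_ord (leq_pred n) j).
Proof.
rewrite mxE (bigD1 (widen_ord (leq_pred n) j)) //= big1 => [|k kj]; last first.
  by rewrite [X in _ * X]mxE (negbTE kj) mulr0.
rewrite addr0 [X in _ * X]mxE eqxx mulr1 mxE.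
rewrite (bigD1 (widen_ord (leq_pred n) i)) //= big1 => [|k ki]; last first.
  by rewrite !mxE (negbTE ki) mul0r.
by rewrite !mxE eqxx mul1r addr0.
Qed.

Lemma ebasis_form (R : realType) (n : nat) (M : 'M[R]_n) (v : 'cV[R]_n) o :
  ((ebasis R o)^T *m M *m v) 0 0 = (M *m v) o 0.
Proof. by rewrite /ebasis trmx_delta -mulmxA -rowE mxE. Qed.

(* [A o o + \sum_j A o (emb j) * Y j 0] is the Schur complement of
   [S^T A S] in [A], so its inverse is the last diagonal entry of [A^-1]. *)
Lemma output_unstable_Schur (R : realType) (n : nat) (hn : (0 < n)%N) (A : 'M[R]_n) :
  let N := (Smat R n)^T *m A *m Smat R n in
  let o := lastIdx hn in
  let emb := widen_ord (leq_pred n) in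
  Metzler A -> output_unstable hn A -> A \in unitmx ->
  Metzler N /\ exists w Y : 'cV[R]_n.-1,
  [/\ forall i, 0 < w i 0, forall i, (N *m w) i 0 < 0, forall i, 0 <= Y i 0,
      N *m Y = - \col_i A (emb i) o
    & let h := A o o + \sum_j A o (emb j) * Y j 0 in
      0 < h /\ (invmx A *m ebasis R o) o 0 = h^-1].
Proof.
move=> N o emb AM [NH]; rewrite ebasis_form /ebasis -colE mxE -/o => Aoo Au.
have embo i : emb i != o.
  by rewrite -val_eqE /= ltn_eqF.
have NM : Metzler N by move=> i j ij; rewrite Smat_conjE AM.
split=> //; have [w w0 Nw] := Hurwitz_Metzler_supersolution NM NH.
have Nu : N \in unitmx.
  by have := Hurwitz_shift_unit NH (lexx 0); rewrite raddf0 sub0r -scaleN1r unitmxZ ?unitrN1.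
pose b := \col_i A (emb i) o; pose Y := - (invmx N *m b).
have NY : N *m Y = - b by rewrite mulmxN mulKVmx.
have Y0 : forall i, 0 <= Y i 0.
  by apply: (Metzler_min_principle NM w0 Nw) => i; rewrite NY !mxE oppr_le0 AM.
exists w, Y; split=> //= ; set h := _ + _.
have h0 : 0 < h.
  by rewrite ltr_pwDl // sumr_ge0 // => j _; rewrite mulr_ge0 // AM // eq_sym.
split=> //; set X := invmx A *m _.
have AX : A *m X = delta_mx o 0 by rewrite mulKVmx.
move: X AX => X AX.
pose X1 : 'cV[R]_n.-1 := \col_j X (emb j) 0.
have NX : N *m X1 = N *m (X o 0 *: Y).
  rewrite -scalemxAr NY; apply/colP => i.
  have /matrixP/(_ (emb i) 0) := AX; rewrite [in LHS]mxE (sum_lastIdx hn) -/o.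
  rewrite mxE (negbTE (embo i)) => /eqP; rewrite addr_eq0 => /eqP XE.
  rewrite !mxE mulrN mulrC -XE; apply: eq_bigr => j _.
  by rewrite Smat_conjE mxE.
have {NX} X1E : X1 = X o 0 *: Y by rewrite -[X1](mulKmx Nu) NX mulKmx.
have /matrixP/(_ o 0) := AX; rewrite [in LHS]mxE (sum_lastIdx hn) -/o mxE !eqxx /=.
rewrite (eq_bigr (fun j => A o (emb j) * Y j 0 * X o 0)) => [|j _]; last first.
  by have /colP/(_ j) := X1E; rewrite !mxE => ->; ring.
rewrite -mulr_suml -mulrDl addrC -/h => hX.
by rewrite -[LHS](mulKf (lt0r_neq0 h0)) hX mulr1.
Qed.

Lemma ReD (R : rcfType) (a b : R[i]) :
  complex.Re (a + b) = complex.Re a + complex.Re b.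
Proof. by case: a; case: b. Qed.

Lemma Re_scale (R : rcfType) (a : R) (z : R[i]) :
  complex.Re ((a%:C)%C * z) = a * complex.Re z.
Proof. by case: z => x y /=; rewrite mul0r subr0. Qed.

Lemma Re_inv_ge0 (R : rcfType) (z : R[i]) :
  0 <= complex.Re z -> 0 <= complex.Re z^-1.
Proof.
by case: z => x y /= x0; rewrite divr_ge0 // addr_ge0 // sqr_ge0.
Qed.

(* Eliminating the controller states, [s / xi] equals
   [l + u + (p u / (p + q)) (q / l + p / (l + p + q))], whose last summand
   is positive real. *)
Lemma controller_loop_bound (R : rcfType) (l s xi z1 z2 : R[i])
    (u p q k theta : R) :
  0 <= complex.Re l -> 0 < u -> 0 < p -> 0 < q -> 0 < theta ->
  k * theta = p * u -> xi != 0 ->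
  s - (u%:C)%C * xi - (k%:C)%C * z2 = l * xi ->
  - (q%:C)%C * z1 - (p%:C)%C * z2 = l * z1 ->
  (theta%:C)%C * xi - (q%:C)%C * z1 - (p%:C)%C * z2 = l * z2 ->
  u * normc xi <= normc s.
Proof.
move=> l0 u0 p0 q0 t0 kt xi0 E1 E2 E3.
have realP (a : R) : 0 < a -> (a%:C)%C != 0.
  by move=> a0; rewrite (fmorph_eq0 (real_complex R)) gt_eqF.
have shiftP (a : R) : 0 < a -> l + (a%:C)%C != 0.
  move=> a0; apply/eqP => /(congr1 (@complex.Re R)); rewrite ReD /=; lra.
have pq0 : 0 < p + q by lra.
have E4 : z2 * (l * (l + ((p + q)%:C)%C)) = (theta%:C)%C * (l + (q%:C)%C) * xi.
  rewrite rmorphD /=; set P := (p%:C)%C in E2 E3 *; set Q := (q%:C)%C in E2 E3 *.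
  have -> : (theta%:C)%C * (l + Q) * xi = (l + Q) * (l * z2 + Q * z1 + P * z2).
    by rewrite -E3; ring.
  have -> : (l + Q) * (l * z2 + Q * z1 + P * z2) =
    (l + Q) * (l + P) * z2 + Q * (l * z1 + Q * z1) by ring.
  by rewrite -E2; ring.
have ln0 : l != 0.
  apply/eqP => l00; move: E4; rewrite l00 mul0r mulr0 add0r => /esym/eqP.
  by rewrite !mulf_eq0 (negbTE xi0) (negbTE (realP _ t0)) (negbTE (realP _ q0)).
pose c := p * u / (p + q).
have sE : s / xi = l + (u%:C)%C + ((c * q)%:C)%C * l^-1
    + ((c * p)%:C)%C * (l + ((p + q)%:C)%C)^-1.
  have z2E : z2 = (theta%:C)%C * (l + (q%:C)%C) * xi / (l * (l + ((p + q)%:C)%C)).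
    by rewrite -E4 mulfK // mulf_neq0 ?shiftP.
  have -> : s = l * xi + (u%:C)%C * xi + (k%:C)%C * z2 by rewrite -E1; ring.
  have -> : (k%:C)%C * z2 = (p%:C)%C * (u%:C)%C * (l + (q%:C)%C) * xi
      / (l * (l + ((p + q)%:C)%C)).
    by rewrite z2E -(rmorphM (real_complex R) p) -kt rmorphM /=; ring.
  have := shiftP _ pq0; have := realP _ pq0.
  rewrite /c !rmorphM fmorphV /= !rmorphD /= => ? ?.
  by field; apply/and4P.
have -> : s = s / xi * xi by rewrite divfK.
rewrite ComplexField.Normc.normcM ler_wpM2r ?normc_nneg //.
apply: le_trans (Re_le_normc _); rewrite sE !ReD !Re_scale /=.
have c0 : 0 < c by rewrite divr_gt0 ?mulr_gt0.
have : 0 <= c * q * complex.Re l^-1.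
  by rewrite mulr_ge0 ?Re_inv_ge0 // mulr_ge0 // ltW.
have : 0 <= c * p * complex.Re (l + ((p + q)%:C)%C)^-1.
  rewrite mulr_ge0 ?Re_inv_ge0 //; first by rewrite mulr_ge0 // ltW.
  by rewrite ReD /=; lra.
rewrite ?rmorphD /=; lra.
Qed.

Lemma sum_lastIdx2 (V : nmodType) (n : nat) (hn : (0 < n)%N) (F : 'I_(n + 2) -> V) :
  \sum_i F i = \sum_j F (lshift 2 (widen_ord (leq_pred n) j))
    + F (lshift 2 (lastIdx hn)) + F (rshift n 0) + F (rshift n 1).
Proof.
rewrite big_split_ord /= (sum_lastIdx hn) big_ord_recl big_ord1 addrA.
by congr (_ + F (rshift n _)); apply: val_inj.
Qed.

Theorem mainTheorem13 (R : realType) (n : nat) (hn : (2 <= n)%N)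
  (A : 'M[R]_n) (b0 : 'cV[R]_n) (mu theta : R) :
  Metzler A ->
  output_unstable (ltnW hn) A ->
  A \in unitmx ->
  (forall i, 0 <= b0 i 0) ->
  let en := ebasis R (lastIdx (ltnW hn)) in
  let g0 := - ((en^T *m invmx A *m b0) 0 0) in
  g0 < 0 ->
  0 < mu -> 0 < theta ->
  let r := mu / theta in
  let gn := - ((en^T *m invmx A *m en) 0 0) in
  let ustar := (g0 - r) / (gn * r) in
  forall eta kp : R, 0 < eta -> 0 < kp ->
  let xstar := - (invmx A *m (b0 - (r * ustar) *: en)) in
  let sstar : 'cV[R]_(n + 2) :=
    col_mx xstar (\col_(k < 2) (if k == 0 then mu / (eta * ustar) else ustar / kp)) in
  vfield (ltnW hn) A b0 mu theta eta kp sstar = 0 /\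
  loc_exp_stable (vfield (ltnW hn) A b0 mu theta eta kp) sstar.
Proof.
move=> AM AO Au _; set o := lastIdx (ltnW hn).
move=> en g0 g0_lt0 mu0 theta0 r gn ustar eta kp eta0 kp0 xstar sstar.
have [NM [w [Y [w0 Nw Y0 NY]]]] := output_unstable_Schur AM AO Au.
set N := _ *m A *m _ in NM Nw NY; set h := _ + _ => /= -[h0 hE].
have r0 : 0 < r by rewrite divr_gt0.
have gnE : gn = - h^-1 by rewrite /gn ebasis_form hE.
have uE : ustar = h * (r - g0) / r.
  by rewrite /ustar gnE; field; rewrite !gt_eqF.
have hu : h < ustar by rewrite uE ltr_pdivlMr // ltr_pM2l //; lra.
have u0 : 0 < ustar := lt_trans h0 hu.
have xo : xstar o 0 = r.
  rewrite /xstar mulmxBr -scalemxAr opprB mxE [X in X + _]mxE [X in _ + X]mxE hE.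
  rewrite -(ebasis_form _ b0) -/en -/g0 uE; field.
  by rewrite !gt_eqF.
split.
  rewrite /vfield /sstar col_mxKu col_mxKd -/o -/en xo !mxE /=.
  rewrite -[RHS]vsubmxK; congr col_mx; last first.
    apply/colP => k; rewrite !mxE /r; case: ifP => _; field; rewrite ?gt_eqF //.
  rewrite mulmxN mulKVmx // linear0 /=.
  rewrite (_ : kp * r * (ustar / kp) = r * ustar); last by field; rewrite gt_eqF.
  by rewrite opprB addrAC subrK subrr.
move=> l; rewrite /sstar jacobian_vfield -/o xo !mxE /= => /eigenvalue_right[U UE U0].
rewrite ltNge; apply/negP => l0.
pose emb := widen_ord (leq_pred n).
pose y j := U (lshift 2 (emb j)) 0.
pose xi := U (lshift 2 o) 0; pose z1 := U (rshift n 0) 0; pose z2 := U (rshift n 1) 0.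
pose q := eta * ustar; pose p := kp * mu / ustar.
have q0 : 0 < q by exact: mulr_gt0.
have p0 : 0 < p by apply: divr_gt0 => //; exact: mulr_gt0.
have embo i : (emb i == o) = false by apply/eqP => /(congr1 val)/= /eqP; rewrite ltn_eqF.
have kpE : kp * (ustar / kp) = ustar by rewrite mulrC divfK ?gt_eqF.
have qE : kp * eta * (ustar / kp) = q by rewrite /q; field; rewrite gt_eqF.
have pE : kp * eta * (mu / (eta * ustar)) = p by rewrite /p; field; rewrite !gt_eqF.
set J := map_mx _ _ in UE.
have J11 i j : J (lshift 2 i) (lshift 2 j) =
    ((A i j - ustar * ((i == o) && (j == o))%:R)%:C)%C.
  by rewrite mxE block_mxEul !mxE kpE.
have J12 i k : J (lshift 2 i) (rshift n k) =
    ((- (kp * r * ((i == o) && (k == 1))%:R))%:C)%C.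
  by rewrite mxE block_mxEur !mxE.
have J21 k j : J (rshift n k) (lshift 2 j) =
    ((theta * ((k == 1) && (j == o))%:R)%:C)%C.
  by rewrite mxE block_mxEdl !mxE.
have J22 k j : J (rshift n k) (rshift n j) = ((- (if j == 0 then q else p))%:C)%C.
  rewrite mxE block_mxEdr !mxE.
  by case/orP: (ord2_total j) => /eqP -> /=; rewrite ?qE ?pE.
have rowE i : \sum_k J i k * U k 0 = l * U i 0.
  by have := congr1 (fun M : 'cV__ => M i 0) UE; rewrite !mxE.
have Ey i : \sum_j ((N i j)%:C)%C * y j + ((A (emb i) o)%:C)%C * xi = l * y i.
  rewrite -rowE (sum_lastIdx2 (ltnW hn)) -/o J11 !J12 embo /= !mulr0 subr0 oppr0.
  rewrite !mul0r !addr0; congr (_ + _); apply: eq_bigr => j _.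
  by rewrite J11 embo /= mulr0 subr0 /N Smat_conjE.
have Ex : (\sum_j ((A o (emb j))%:C)%C * y j + ((A o o)%:C)%C * xi)
    - (ustar%:C)%C * xi - ((kp * r)%:C)%C * z2 = l * xi.
  rewrite -rowE (sum_lastIdx2 (ltnW hn)) -/o J11 !J12 !eqxx /= !mulr1 mulr0 oppr0.
  rewrite rmorphB rmorphN /= mul0r addr0.
  rewrite [in RHS](eq_bigr (fun j => ((A o (emb j))%:C)%C * y j)) => [|j _]; last first.
    by rewrite J11 embo andbF mulr0 subr0.
  by rewrite -/xi -/z2; ring.
have Ez1 : - (q%:C)%C * z1 - (p%:C)%C * z2 = l * z1.
  rewrite -rowE (sum_lastIdx2 (ltnW hn)) -/o J21 !J22 /= mulr0 mul0r big1.
    by rewrite !add0r !rmorphN /= !mulNr.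
  by move=> j _; rewrite J21 /= mulr0 mul0r.
have Ez2 : (theta%:C)%C * xi - (q%:C)%C * z1 - (p%:C)%C * z2 = l * z2.
  rewrite -rowE (sum_lastIdx2 (ltnW hn)) -/o J21 !J22 !eqxx /= mulr1 big1.
    by rewrite add0r !rmorphN /= !mulNr.
  by move=> j _; rewrite J21 embo andbF mulr0 mul0r.
have yb : forall i, normc (y i) <= normc xi * Y i 0.
  apply: (Metzler_resolvent_bound NM w0 Nw NY _ l0) => i.
    by rewrite mxE AM // embo.
  by rewrite mxE -Ey.
have xi0 : xi != 0.
  apply/eqP => xi0; case/eqP: U0.
  have y00 i : y i = 0.
    apply: ComplexField.Normc.eq0_normc; apply/eqP; rewrite eq_le.
    have := yb i; rewrite xi0 ComplexField.Normc.normc0 mul0r => -> /=.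
    exact: normc_nneg.
  have nz (a : R) : 0 < a -> (a%:C)%C != 0.
    by move=> a0; rewrite (fmorph_eq0 (real_complex R)) gt_eqF.
  have z20 : z2 = 0.
    move: Ex; rewrite xi0 !mulr0 big1 => [|j _]; last by rewrite y00 mulr0.
    rewrite addr0 subr0 sub0r => /eqP; rewrite oppr_eq0 mulf_eq0.
    by rewrite (negbTE (nz _ (mulr_gt0 kp0 r0))) /= => /eqP.
  have z10 : z1 = 0.
    move: Ez2; rewrite xi0 z20 !mulr0 subr0 sub0r => /eqP; rewrite oppr_eq0 mulf_eq0.
    by rewrite (negbTE (nz _ _)) //= => /eqP.
  apply/colP => k; rewrite [RHS]mxE; case: (split_ordP k) => j ->; last first.
    by case/orP: (ord2_total j) => /eqP ->.
  have [->//|jo] := eqVneq j o.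
  have jn : (j < n.-1)%N.
    have := ltn_ord j; rewrite -{2}(prednK (ltnW hn)) ltnS leq_eqVlt.
    by rewrite (negbTE (jo : (j : nat) != n.-1)).
  by rewrite -(y00 (Ordinal jn)) /y; congr (U (lshift 2 _) 0); apply: val_inj.
have krt : kp * r * theta = p * ustar.
  by rewrite /r /p; field; rewrite !gt_eqF.
have := controller_loop_bound l0 u0 p0 q0 theta0 krt xi0 Ex Ez1 Ez2.
have nxi : 0 < normc xi.
  rewrite lt_neqAle normc_nneg andbT.
  by apply: contraNneq xi0 => /esym/ComplexField.Normc.eq0_normc ->.
rewrite leNgt => /negP; apply.
apply: (@le_lt_trans _ _ (h * normc xi)); last by rewrite ltr_pM2r.
have Aoo0 : 0 <= A o o.
  by case: AO => _; rewrite ebasis_form /ebasis -colE mxE => /ltW.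
apply: le_trans (le_normcD _ _) _; rewrite ComplexField.Normc.normcM normc_real //.
rewrite /h mulrDl addrC lerD2l mulr_suml.
apply: le_trans (normc_sum _ _) _; apply: ler_sum => j _.
have Aoj : 0 <= A o (emb j) by rewrite AM // eq_sym embo.
rewrite ComplexField.Normc.normcM normc_real // -mulrA ler_wpM2l //.
by rewrite mulrC.
Qed.
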